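(* For every integer $i\ge 7$, let $S_i:=F_{i-1}[1\ldots f_{i-1}-2]$ be the prefix of $F_{i-1}$ of length $f_{i-1}-2$. Taking $F_i$ as the text, the net frequency of $S_i$ in $F_i$ satisfies $\phi(S_i)\ge 2$.
   Context: Fibonacci words: $F_1=\texttt{b}$, $F_2=\texttt{a}$, $F_i=F_{i-1}F_{i-2}$ for $i\ge 3$; $f_i=|F_i|$. For a text $T$ of length $n$, let $f(W)$ be the number of occurrences of $W$ in $T$. An occurrence $(s,e)$, $1\le s\le e\le n$, is a net occurrence if $f(T[s\ldots e])\ge 2$, $f(T[s-1\ldots e])=1$ and $f(T[s\ldots e+1])=1$, where the second condition is considered true when $s=1$ and the third when $e=n$. The net frequency $\phi(S)$ of $S$ in $T$ is the number of net occurrences $(s,e)$ with $T[s\ldots e]=S$. *)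

(* Defs.v *)
From HB Require Import structures.
From mathcomp Require Import all_boot.

Set Implicit Arguments.
Unset Strict Implicit.
Unset Printing Implicit Defensive.

Inductive letter := La | Lb.

Definition letter_is_a (x : letter) : bool := if x is La then true else false.
Definition letter_of_bool (c : bool) : letter := if c then La else Lb.
Lemma letter_is_aK : cancel letter_is_a letter_of_bool.
Proof. by case. Qed.

HB.instance Definition _ := Equality.copy letter (can_type letter_is_aK).

(* Indexed from 1; the value at 0 is a dummy. *)
Fixpoint fibword (i : nat) : seq letter :=
  match i with
  | 0 => [::]
  | 1 => [:: Lb]
  | (k.+1 as k').+1 => if k == 0 then [:: La] else fibword k' ++ fibword k
  end.

Definition fiblen (i : nat) : nat := size (fibword i).

Section Text.

Variable (A : eqType).
Implicit Types (T W : seq A) (s e : nat).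

(* T[s..e], with 1-based inclusive endpoints. *)
Definition factor T s e : seq A := drop s.-1 (take e T).

(* All pairs (s, e) with 1 <= s <= e <= size T, each listed once. *)
Definition positions T : seq (nat * nat) :=
  [seq (s, e) | s <- iota 1 (size T), e <- iota s ((size T).+1 - s)].

Definition frequency T W : nat :=
  count (fun o => factor T o.1 o.2 == W) (positions T).

Definition net_occurrence T s e : bool :=
  [&& 1 <= s, s <= e, e <= size T,
      2 <= frequency T (factor T s e),
      (s == 1) || (frequency T (factor T s.-1 e) == 1) &
      (e == size T) || (frequency T (factor T s e.+1) == 1)].

Definition net_frequency T W : nat :=
  count (fun o => net_occurrence T o.1 o.2 && (factor T o.1 o.2 == W))
        (positions T).

End Text.

(* Main.v *)
Require Import Defs.
From mathcomp Require Import all_boot.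
From mathcomp Require Import zify.

(** Write [T = F_i = w v w] with [w = F_{i-2}] and [v = F_{i-3}].  The words [w v] and
    [v w] are [C x y] and [C y x] with [x <> y], so [C = S_i] occurs in [T] at offsets
    [0] and [|w|].  Up to its last two letters [T] has period [|w|], hence any other
    occurrence of [C], whose prefix is [w], would make [w] equal to a proper rotation
    of itself.  This is impossible: commuting words have proportional numbers of [a]'s,
    while the length of [F_k] is coprime to its number [f_{k-1}] of [a]'s.  As the two
    occurrences of [C] are followed by different letters and the first one is a prefix
    of [T], both are net occurrences. *)

Set Implicit Arguments.
Unset Strict Implicit.
Unset Printing Implicit Defensive.

Section Count.

Variables (A : eqType) (P : pred A) (s : seq A).

Lemma count_uniq_eq1 x0 :
  uniq s -> x0 \in s -> P x0 -> {in s, forall x, P x -> x = x0} -> count P s = 1.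
Proof.
move=> s_uniq x0s Px0 Px; have <- : count_mem x0 s = 1 by rewrite count_uniq_mem ?x0s.
by apply: eq_in_count => x xs /=; apply/idP/eqP => [/Px ->|->].
Qed.

Lemma count_ge2 x y :
  x \in s -> y \in s -> x != y -> P x -> P y -> 2 <= count P s.
Proof.
move=> xs ys xy Px Py; rewrite -size_filter.
apply: (@uniq_leq_size _ [:: x; y]); first by rewrite /= inE xy.
by move=> z; rewrite !inE mem_filter => /orP[]/eqP->; rewrite ?Px ?Py.
Qed.

End Count.

(** * Occurrences of factors, rotations, and texts of the form w v w *)

Section Factors.

Variable A : eqType.
Implicit Types (T u v w C : seq A).

Lemma uniq_positions T : uniq (positions T).
Proof.
apply: allpairs_uniq_dep; rewrite ?iota_uniq //.
- by move=> s _; apply: iota_uniq.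
- by move=> [s e] [s' e'] _ _ [-> ->].
Qed.

Lemma mem_positions T s e :
  ((s, e) \in positions T) = [&& 1 <= s, s <= e & e <= size T].
Proof.
apply/allpairsPdep/idP => [[s' [e' [+ + [-> ->]]]]|]; first by rewrite !mem_iota; lia.
by move=> se; exists s, e; split; rewrite ?mem_iota //; lia.
Qed.

(** Lengths are compared additively to avoid truncated subtraction, and letters by offset in [T], so
    that later arguments only handle [nth x0 T]. *)
Lemma factor_eqP x0 T s e s' e' :
  [&& 1 <= s, s <= e & e <= size T] -> [&& 1 <= s', s' <= e' & e' <= size T] ->
  reflect (e + s' = e' + s /\
           forall j, j <= e - s -> nth x0 T (s.-1 + j) = nth x0 T (s'.-1 + j))
          (factor T s e == factor T s' e').
Proof.
move=> se se'.
have sizeF t f : [&& 1 <= t, t <= f & f <= size T] -> size (factor T t f) = f - t.-1.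
  by move=> tf; rewrite size_drop size_takel //; lia.
have nthF t f j : [&& 1 <= t, t <= f & f <= size T] -> j <= f - t ->
    nth x0 (factor T t f) j = nth x0 T (t.-1 + j).
  by move=> tf jf; rewrite nth_drop nth_take //; lia.
apply: (iffP eqP) => [eqF|[eq_size eq_nth]].
  have := congr1 size eqF; rewrite !sizeF // => eq_size.
  split=> [|j je]; first by lia.
  by rewrite -(nthF s e) // eqF nthF //; lia.
apply: (@eq_from_nth _ x0); first by rewrite !sizeF //; lia.
by move=> j; rewrite sizeF // => je; rewrite !nthF ?eq_nth //; lia.
Qed.

Lemma frequency_eq1 x0 T s e : [&& 1 <= s, s <= e & e <= size T] ->
  (forall s', 1 <= s' -> s' + e <= size T + s ->
    (forall j, j <= e - s -> nth x0 T (s'.-1 + j) = nth x0 T (s.-1 + j)) -> s' = s) ->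
  frequency T (factor T s e) = 1.
Proof.
move=> se uniq_s; apply: (@count_uniq_eq1 _ _ _ (s, e)) => //.
  exact: uniq_positions.
  by rewrite mem_positions.
move=> [s' e']; rewrite mem_positions => se' /= /(factor_eqP x0 se' se)[szE nthE].
have ss' : s' = s by apply: uniq_s => [||j je]; [lia|lia|apply: nthE; lia].
by congr pair; lia.
Qed.

(** Euclidean descent: the shorter word is a prefix of the longer one, and removing it leaves a
    commuting pair of smaller total length; sizes and counts are additive. *)
Lemma commuting_size_count (P : pred A) u v :
  u ++ v = v ++ u -> size u * count P v = size v * count P u.
Proof.
have [n] := ubnP (size u + size v).
elim: n u v => // n IHn u v; wlog uv : u v / size u <= size v.
  move=> IH lt_n eq_uv; case: (leqP (size u) (size v)) => [uv|/ltnW uv]; first exact: IH.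
  by apply/esym/IH => //; lia.
case: u uv => [|a u] uv lt_n eq_uv; first by rewrite /= mul0n muln0.
have def_v : v = (a :: u) ++ drop (size (a :: u)) v.
  rewrite -{1}(cat_take_drop (size (a :: u)) v); congr (_ ++ _).
  by have := congr1 (take (size (a :: u))) eq_uv; rewrite take_size_cat // takel_cat.
move: def_v; set v' := drop _ v => def_v.
have eq_uv' : (a :: u) ++ v' = v' ++ (a :: u).
  by move/eqP: eq_uv; rewrite {1 2}def_v -catA eqseq_cat // eqxx => /eqP.
have := IHn _ _ _ eq_uv'; rewrite def_v size_cat count_cat.
move: lt_n; rewrite def_v size_cat /=; move: (size u) (size v') (count P u) (count P v').
by move=> ? ? ? ? lt_n /(_ ltac:(lia)) H; rewrite mulnDr mulnDl H.
Qed.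

(** If the rotation fixed [w], its two pieces would commute, whence [size w] divides
    [p * count P w], hence [p]. *)
Lemma coprime_count_rot (P : pred A) w p :
  coprime (size w) (count P w) -> 0 < p < size w -> rot p w != w.
Proof.
move=> co_w p_w; apply/eqP => rot_w.
have eq_uv : take p w ++ drop p w = drop p w ++ take p w by rewrite cat_take_drop.
have := commuting_size_count P eq_uv.
have := count_cat P (take p w) (drop p w); rewrite cat_take_drop.
rewrite size_drop size_takel; last by lia.
move=> cnt prop; have : size w %| p * count P w.
  apply/dvdnP; exists (count P (take p w)).
  rewrite cnt mulnDr prop -mulnDl mulnC; congr (_ * _); lia.
by rewrite Gauss_dvdl // => /dvdn_leq; lia.
Qed.

Lemma net_frequency_border_ge2 w v C x y : x != y ->
  w ++ v = C ++ [:: x; y] -> v ++ w = C ++ [:: y; x] ->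
  2 < size w -> 3 < size v -> (forall p, 0 < p < size w -> rot p w != w) ->
  2 <= net_frequency (w ++ v ++ w) C.
Proof.
move=> xy wvE vwE w_gt2 v_gt3 w_rot; set T := w ++ v ++ w.
set q := size w in w_gt2 w_rot *; set c := size C.
have cE : c + 2 = q + size v.
  by have := congr1 size wvE; rewrite !size_cat /= /q /c; lia.
have szT : size T = q + c + 2 by rewrite !size_cat /q; move: cE; rewrite /q; lia.
have T1 j : nth x T j = nth x (C ++ [:: x; y] ++ w) j by rewrite /T catA wvE -catA.
have T2 j : nth x T (q + j) = nth x (C ++ [:: y; x]) j.
  by rewrite /T vwE nth_cat ltnNge leq_addr /= addKn.
have Tc : nth x T c = x by rewrite T1 nth_cat ltnn subnn.
have Tqc : nth x T (q + c) = y by rewrite T2 nth_cat ltnn subnn.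
have T_C j : j < c -> nth x T j = nth x C j by move=> jc; rewrite T1 nth_cat jc.
have T_per j : j < c -> nth x T (q + j) = nth x T j.
  by move=> jc; rewrite T2 nth_cat jc T_C.
have T_mod j : j < q + c -> nth x T j = nth x w (j %% q).
  elim/ltn_ind: j => j IHj jqc; have [jq|qj] := ltnP j q.
    by rewrite modn_small // /T nth_cat jq.
  rewrite -(subnKC qj) T_per; last by lia.
  by rewrite IHj ?modnDl //; lia.
(* Offsets are 0-based, and [q + 2] is the last one at which a word of length [c] fits in [T]. As
   [q > 2], it is below [2 * q], so the only multiples of [q] are 0 and [q]. As [size v > 3], we
   have [c >= q + 2], so the first [q] letters of the window stay in the range of [T_mod]. *)
have occ p : p <= q + 2 -> (forall j, j < c -> nth x T (p + j) = nth x T j) ->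
    p = 0 \/ p = q.
  move=> pq pC; have [|p_neq0] := posnP (p %% q).
    move/eqP/dvdnP=> [k pE]; case: k pE => [|[|k]] pE; [lia|lia|].
    by rewrite pE !mulSn in pq; lia.
  suff rot_w : rot (p %% q) w = w.
    by have := w_rot (p %% q); rewrite rot_w eqxx p_neq0 ltn_mod; lia.
  have pq_lt : p %% q < q by rewrite ltn_mod; lia.
  apply: (@eq_from_nth _ x); first by rewrite size_rot.
  rewrite size_rot -/q => j jq.
  have -> : nth x w j = nth x w ((p + j) %% q).
    by rewrite -[in LHS](modn_small jq) -!T_mod ?pC //; lia.
  rewrite -modnDml /rot nth_cat size_drop -/q; case: ltnP => jp.
    by rewrite nth_drop (@modn_small (p %% q + j)) //; lia.
  rewrite nth_take; last by lia.
  congr (nth x w _); rewrite -(@modn_small (j - (q - p %% q)) q); last by lia.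
  by rewrite -[in LHS]modnDr; congr (_ %% q); lia.
have C1 : factor T 1 c = C.
  by rewrite /factor drop0 /T catA wvE -catA take_size_cat.
have C2 : factor T q.+1 (q + c) = C.
  rewrite -[RHS]C1; apply/eqP/(factor_eqP x); [lia|lia|split=> [|j jc]; first lia].
  by rewrite /= T_per //; lia.
have freqC : 2 <= frequency T C.
  apply: (@count_ge2 _ _ _ (1, c) (q.+1, q + c)).
  - by rewrite mem_positions; lia.
  - by rewrite mem_positions; lia.
  - by rewrite xpair_eqE; lia.
  - by rewrite /= C1.
  - by rewrite /= C2.
have right1 : frequency T (factor T 1 c.+1) = 1.
  apply: (@frequency_eq1 x); first by lia.
  move=> s s_gt0 s_le sC; case: (occ s.-1) => [|j jc||s_q]; [lia| |lia|].
    by rewrite sC ?add0n //; lia.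
  have := sC c; rewrite s_q Tqc /= add0n Tc => /(_ ltac:(lia)) yx.
  by rewrite yx eqxx in xy.
have left2 : frequency T (factor T q (q + c)) = 1.
  apply: (@frequency_eq1 x); first by lia.
  (* Dropping the first letter of the extended factor leaves [C] at 0-based offset [s], not [s.-1];
     since [s > 0], only [q] remains. *)
  move=> s s_gt0 s_le sC; case: (occ s) => [|j jc||//]; [lia| |lia].
  have := sC j.+1; rewrite !addnS -!addSn !prednK; [|lia|lia].
  by move=> -> //; rewrite ?T_per //; lia.
have right2 : frequency T (factor T q.+1 (q + c).+1) = 1.
  apply: (@frequency_eq1 x); first by lia.
  move=> s s_gt0 s_le sC; case: (occ s.-1) => [|j jc|s_0|]; [lia| | |lia].
    by rewrite sC /= ?T_per //; lia.
  have := sC c; rewrite s_0 /= add0n Tc Tqc => /(_ ltac:(lia)) yx.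
  by rewrite yx eqxx in xy.
apply: (@count_ge2 _ _ _ (1, c) (q.+1, q + c)).
- by rewrite mem_positions; lia.
- by rewrite mem_positions; lia.
- by rewrite xpair_eqE; lia.
- by rewrite /net_occurrence /= C1 freqC right1 !eqxx orbT !andbT; lia.
- by rewrite /net_occurrence /= C2 freqC left2 right2 !eqxx !orbT !andbT; lia.
Qed.

End Factors.

(** * Fibonacci words: near-commutation, letter counts and lengths *)

Lemma fibwordS k : 0 < k -> fibword k.+2 = fibword k.+1 ++ fibword k.
Proof. by case: k. Qed.

Lemma fiblenS k : 0 < k -> fiblen k.+2 = fiblen k.+1 + fiblen k.
Proof. by move=> k_gt0; rewrite /fiblen fibwordS // size_cat. Qed.

(** Unfolding the longest word shows that both products at the next index start with the same
    Fibonacci word, followed by the two products at the current index in swapped order; so [x] and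
    [y] trade places at each step. *)
Lemma fibword_near_commute k : 0 < k -> exists C x y,
  [/\ x != y, fibword k.+1 ++ fibword k = C ++ [:: x; y]
    & fibword k ++ fibword k.+1 = C ++ [:: y; x]].
Proof.
elim: k => // -[|k] IHk _; first by exists [::], La, Lb.
have [//|C [x [y [xy eq1 eq2]]]] := IHk.
exists (fibword k.+2 ++ C), y, x.
by rewrite eq_sym fibwordS // -!catA eq1 eq2.
Qed.

Lemma count_La_fibword k : 0 < k -> count_mem La (fibword k.+1) = fiblen k.
Proof.
elim/ltn_ind: k => -[|[|[|k]]] IHk // _.
by rewrite fibwordS // count_cat !IHk // (@fiblenS k.+1).
Qed.

Lemma coprime_fiblen k : 0 < k -> coprime (fiblen k.+1) (fiblen k).
Proof.
elim: k => // -[|k] IHk _ //.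
by rewrite fiblenS // coprime_sym /coprime gcdnDl; apply: IHk.
Qed.

(** A crude linear bound, enough for the length hypotheses of [net_frequency_border_ge2]. *)
Lemma fiblen_ge k : k.+4 <= fiblen k.+4.+1.
Proof.
elim: k => // k IHk; rewrite fiblenS //.
suff: 0 < fiblen k.+4 by lia.
by elim: {IHk} k => // k IHk; rewrite fiblenS // addn_gt0 IHk.
Qed.

Theorem theorem11 (i : nat) (hi : 7 <= i) :
  2 <= net_frequency (fibword i) (factor (fibword i.-1) 1 (fiblen i.-1 - 2)).
Proof.
(* Here [//] also settles [i = 7] by computation: [F_4] is too short for
   [net_frequency_border_ge2]. *)
case: i hi => [|[|[|[|[|[|[|[|k]]]]]]]] // _.
(* Now [i] is [k.+4.+4], so this index pairs $F_{i-2}$ with $F_{i-3}$. *)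
have [//|C [x [y [xy eq1 eq2]]]] := @fibword_near_commute k.+4.+1.
have -> : factor (fibword k.+4.+4.-1) 1 (fiblen k.+4.+4.-1 - 2) = C.
  rewrite /factor drop0 /fiblen [k.+4.+4.-1]/= fibwordS // eq1 size_cat addnK.
  by rewrite take_size_cat.
rewrite fibwordS // (@fibwordS k.+4.+1) // -catA.
have sz5 : k.+4 <= fiblen k.+4.+1 := fiblen_ge k.
have sz6 : k.+4.+1 <= fiblen k.+4.+2 := fiblen_ge k.+1.
apply: (net_frequency_border_ge2 xy) => //; rewrite -?/(fiblen _); [lia|lia|].
move=> p; apply: (@coprime_count_rot _ (pred1 La)).
by rewrite count_La_fibword // coprime_fiblen.
Qed.
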